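(* Let $A$ be a commutative ring, $k\ge1$, and $\vec s=(n_1,\dots,n_k)$ a tuple of positive integers. Then the diagonal simplicial tensor module $X_\bullet(\vec s;A)$ is contractible.
   Context: Notation: $[p]=\{0,\dots,p\}$. For a shape $\vec s=(n_1,\dots,n_k)$ put $n=\min(n_1,\dots,n_k)-1$, $M_a(p)=n_a-1-n+p$ (so $M_a(p)\ge p$) and $I_p=\prod_{a=1}^k[M_a(p)]$ for $p\ge 0$. Let $\delta_i^q:[q-1]\to[q]$ be the increasing injection missing $i$ and $\sigma_i^q:[q+1]\to[q]$ the nondecreasing surjection taking the value $i$ twice. Define $\Delta_i^p=\prod_{a=1}^k\delta_i^{M_a(p)}:I_{p-1}\to I_p$ ($p\ge1$, $0\le i\le p$) and $\Sigma_i^p=\prod_{a=1}^k\sigma_i^{M_a(p)}:I_{p+1}\to I_p$ ($p\ge 0$, $0\le i\le p$). The diagonal simplicial tensor module $X_\bullet(\vec s;A)$ is the simplicial $A$-module with $X_p=A^{I_p}$ (all functions $T:I_p\to A$), faces $d_i^p(T)=T\circ\Delta_i^p$ and degeneracies $s_i^p(T)=T\circ\Sigma_i^p$. Its associated unaugmented chain complex has $X_p$ in degree $p\ge0$, $X_p=0$ for $p<0$, $\partial_0=0$, and $\partial_p=\sum_{i=0}^p(-1)^id_i^p$ for $p\ge1$. ''Contractible'' means that this chain complex admits a chain contraction: $A$-linear maps $H_p:X_p\to X_{p+1}$ for $p\ge-1$ (with $H_{-1}=0$) such that $\partial_{p+1}H_p+H_{p-1}\partial_p=\operatorname{id}_{X_p}$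 for all $p\ge0$. *)

(* Defs.v *)
From HB Require Import structures.
From mathcomp Require Import all_boot all_order all_algebra zify.

Set Implicit Arguments.
Unset Strict Implicit.
Unset Printing Implicit Defensive.

Import GRing.Theory.
Local Open Scope ring_scope.

(* [face p i] is d_i : X_{p+1} -> X_p and [degen p i] is s_i : X_p -> X_{p+1}.
   [lift ord0 j] is the index j+1 and [widen_ord (leqnSn _) i] is i itself, one
   range further, so the fields below are the usual simplicial identities
   with their larger index shifted by one. *)
Record simplicialModule (A : pzRingType) := SimplicialModule {
  simp :> nat -> lmodType A;
  face : forall p, 'I_p.+2 -> {linear simp p.+1 -> simp p};
  degen : forall p, 'I_p.+1 -> {linear simp p -> simp p.+1};
  face_face : forall p (i j : 'I_p.+2) (x : simp p.+2), (i <= j)%N ->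
    face i (face (lift ord0 j) x)
      = face j (face (widen_ord (leqnSn _) i) x);
  degen_degen : forall p (i j : 'I_p.+1) (x : simp p), (i <= j)%N ->
    degen (widen_ord (leqnSn _) i) (degen j x)
      = degen (lift ord0 j) (degen i x);
  face_degen_lt : forall p (i : 'I_p.+2) (j : 'I_p.+1) (x : simp p.+1),
    (i <= j)%N ->
    face (widen_ord (leqnSn _) i) (degen (lift ord0 j) x)
      = degen j (face i x);
  face_degen_eq : forall p (j : 'I_p.+1) (x : simp p),
    face (widen_ord (leqnSn _) j) (degen j x) = x;
  face_degen_eqS : forall p (j : 'I_p.+1) (x : simp p),
    face (lift ord0 j) (degen j x) = x;
  face_degen_gt : forall p (i : 'I_p.+2) (j : 'I_p.+1) (x : simp p.+1),
    (j < i)%N ->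
    face (lift ord0 i) (degen (widen_ord (leqnSn _) j) x)
      = degen j (face i x)
}.

(* Complexes concentrated in nonnegative degrees: [bd p] is the boundary from
   degree p+1 to degree p, and the boundary out of degree 0 is zero. *)
Record chainComplex (A : pzRingType) := ChainComplex {
  chain :> nat -> lmodType A;
  bd : forall p, {linear chain p.+1 -> chain p};
  bd_bd : forall p (x : chain p.+2), bd p (bd p.+1 x) = 0
}.

(* In degree 0 the term H_{-1} \partial_0 vanishes, so H_0 is a section of the
   boundary C_1 -> C_0; in particular the 0-th homology has to vanish. *)
Definition contractible (A : pzRingType) (C : chainComplex A) : Prop :=
  exists H : forall p, {linear C p -> C p.+1},
    (forall x : C 0, bd C 0 (H 0 x) = x) /\
    (forall p (x : C p.+1), bd C p.+1 (H p.+1 x) + H p (bd C p x) = x).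

Section AssociatedComplex.
Variables (A : comPzRingType) (X : simplicialModule A).

Definition alt_face p (x : X p.+1) : X p :=
  \sum_(i < p.+2) (-1) ^+ i *: face X i x.

Fact alt_face_is_linear p : linear (@alt_face p).
Proof.
move=> a x y; rewrite /alt_face scaler_sumr -big_split /=.
apply: eq_bigr => i _.
by rewrite linearP scalerDr !scalerA mulrC.
Qed.

HB.instance Definition _ p :=
  GRing.isLinear.Build A (X p.+1) (X p) *:%R (@alt_face p)
    (alt_face_is_linear (p := p)).

Fact alt_face_alt_face p (x : X p.+2) : alt_face (alt_face x) = 0.
Proof.
pose F (i : 'I_p.+2) (j : 'I_p.+3) :=
  (-1) ^+ (i + j) *: face X i (face X j x).
have -> : alt_face (alt_face x) = \sum_i \sum_j F i j.
  apply: eq_bigr => i _; rewrite raddf_sum scaler_sumr; apply: eq_bigr => j _.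
  by rewrite /F exprD -scalerA; congr (_ *: _); apply: linearZ_LR.
rewrite (eq_bigr (fun i : 'I_p.+2 =>
    \sum_(j < p.+3 | (i < j)%N) F i j
      + \sum_(j < p.+3 | (j <= i)%N) F i j)); last first.
  move=> i _; rewrite (bigID (fun j : 'I_p.+3 => (i < j)%N)) /=.
  by congr (_ + _); apply: eq_bigl => j; rewrite -leqNgt.
rewrite big_split /=.
rewrite (eq_bigr (fun i : 'I_p.+2 =>
    \sum_(j < p.+2 | (i <= j)%N) F i (lift ord0 j))); last first.
  move=> i _; rewrite big_mkcond big_ord_recl /= add0r [RHS]big_mkcond.
  by apply: eq_bigr => j _; rewrite /= /bump add1n.
rewrite [X in _ + X](eq_bigr (fun i : 'I_p.+2 =>
    \sum_(j < p.+2 | (j <= i)%N) F i (widen_ord (leqnSn _) j))); last first.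
  move=> i _; rewrite big_mkcond big_ord_recr /= leqNgt ltn_ord addr0.
  by rewrite [RHS]big_mkcond.
rewrite [X in _ + X](exchange_big_dep xpredT) //= -big_split big1 //= => i _.
rewrite -big_split big1 //= => j le_ij.
rewrite /F face_face //= /bump add1n addnS exprS mulN1r scaleNr.
by rewrite [(j + i)%N]addnC addNr.
Qed.

Definition unaugmentedComplex : chainComplex A :=
  @ChainComplex A X (fun p => @alt_face p : {linear _ -> _}) alt_face_alt_face.

End AssociatedComplex.

(* The coface delta_i^{q+1} : [q] -> [q+1] of the simplex category is [lift i];
   this is the codegeneracy sigma_i^q : [q+1] -> [q]. *)
Fact codegen_subproof q (i : 'I_q.+1) (j : 'I_q.+2) : (unbump i j < q.+1)%N.
Proof.
rewrite /unbump; have := ltn_ord j; case: (ltnP i j) => ij ltj.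
  by rewrite subn1 -ltnS (ltn_predK ij).
by rewrite subn0 (leq_ltn_trans ij).
Qed.

Definition codegen q (i : 'I_q.+1) (j : 'I_q.+2) : 'I_q.+1 :=
  Ordinal (codegen_subproof i j).

Fact bump_bump i j v :
  (i <= j)%N -> bump j.+1 (bump i v) = bump i (bump j v).
Proof. rewrite /bump; lia. Qed.

Fact unbump_unbump i j v :
  (i <= j)%N -> unbump j (unbump i v) = unbump i (unbump j.+1 v).
Proof. rewrite /unbump; lia. Qed.

Fact unbumpS_bump i j v :
  (i <= j)%N -> unbump j.+1 (bump i v) = bump i (unbump j v).
Proof. by rewrite /bump /unbump; case: (leqP i v); case: (ltnP j v); lia. Qed.

Fact unbump_bumpS i j v :
  (j < i)%N -> unbump j (bump i.+1 v) = bump i (unbump j v).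
Proof. by rewrite /bump /unbump; case: (leqP i v); case: (ltnP j v); lia. Qed.

Fact unbump_bump_self j v : unbump j (bump j.+1 v) = v.
Proof. rewrite /bump /unbump; lia. Qed.

Section DiagonalTensor.
Variables (A : comPzRingType) (k : nat) (s : k.-tuple nat).

(* Starting the fold at an entry of s makes it the minimum when 0 < k. *)
Definition shape_min : nat := \big[minn/head 0%N s]_(m <- s) m.
Definition shape_dim : nat := (shape_min - 1)%N.
Definition excess (a : 'I_k) : nat := (tnth s a - 1 - shape_dim)%N.

(* M_a(p), with p on the left so that M_a(p+1) is convertible to M_a(p)+1.
   For positive entries none of the subtractions above truncates. *)
Definition side (p : nat) (a : 'I_k) : nat := (p + excess a)%N.

Definition multiIndex (p : nat) : finType :=
  {dffun forall a : 'I_k, 'I_(side p a).+1}.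

(* [lshift (excess a) i] is i, seen in [0, M_a(p+1)], resp. in [0, M_a(p)]. *)
Definition Delta p (i : 'I_p.+2) (x : multiIndex p) : multiIndex p.+1 :=
  [ffun a => lift (lshift (excess a) i : 'I_(side p.+1 a).+1) (x a)].

Definition Sigma p (i : 'I_p.+1) (x : multiIndex p.+1) : multiIndex p :=
  [ffun a => codegen (lshift (excess a) i : 'I_(side p a).+1) (x a)].

Definition tensor (p : nat) : lmodType A := {ffun multiIndex p -> A^o}.

Definition tensor_pull p q (f : multiIndex p -> multiIndex q) (T : tensor q) :
  tensor p := [ffun x => T (f x)].

Fact tensor_pull_is_linear p q (f : multiIndex p -> multiIndex q) :
  linear (tensor_pull f).
Proof. by move=> a T U; apply/ffunP=> x; rewrite !ffunE. Qed.

HB.instance Definition _ p q (f : multiIndex p -> multiIndex q) :=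
  GRing.isLinear.Build A (tensor q) (tensor p) *:%R (tensor_pull f)
    (tensor_pull_is_linear f).

Fact tensor_pull_eq p q r t (f : multiIndex p -> multiIndex q)
    (g : multiIndex q -> multiIndex t)
    (f' : multiIndex p -> multiIndex r)
    (g' : multiIndex r -> multiIndex t) T :
  (forall x a, g (f x) a = g' (f' x) a :> nat) ->
  tensor_pull f (tensor_pull g T) = tensor_pull f' (tensor_pull g' T).
Proof.
move=> e; apply/ffunP=> x; rewrite !ffunE; congr (T _).
by apply/ffunP=> a; apply/val_inj/e.
Qed.

Fact tensor_pull_id p q (f : multiIndex p -> multiIndex q)
    (g : multiIndex q -> multiIndex p) T :
  (forall x a, g (f x) a = x a :> nat) ->
  tensor_pull f (tensor_pull g T) = T.
Proof.
move=> e; apply/ffunP=> x; rewrite !ffunE; congr (T _).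
by apply/ffunP=> a; apply/val_inj/e.
Qed.

Definition tensor_face p (i : 'I_p.+2) : {linear tensor p.+1 -> tensor p} :=
  tensor_pull (Delta i).
Definition tensor_degen p (i : 'I_p.+1) : {linear tensor p -> tensor p.+1} :=
  tensor_pull (Sigma i).

Fact tensor_face_face p (i j : 'I_p.+2) (T : tensor p.+2) : (i <= j)%N ->
  tensor_face i (tensor_face (lift ord0 j) T)
    = tensor_face j (tensor_face (widen_ord (leqnSn _) i) T).
Proof.
move=> le_ij; apply: tensor_pull_eq => x a.
by rewrite !ffunE; apply: bump_bump.
Qed.

Fact tensor_degen_degen p (i j : 'I_p.+1) (T : tensor p) : (i <= j)%N ->
  tensor_degen (widen_ord (leqnSn _) i) (tensor_degen j T)
    = tensor_degen (lift ord0 j) (tensor_degen i T).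
Proof.
move=> le_ij; apply: tensor_pull_eq => x a.
by rewrite !ffunE; apply: unbump_unbump.
Qed.

Fact tensor_face_degen_lt p (i : 'I_p.+2) (j : 'I_p.+1) (T : tensor p.+1) :
  (i <= j)%N ->
  tensor_face (widen_ord (leqnSn _) i) (tensor_degen (lift ord0 j) T)
    = tensor_degen j (tensor_face i T).
Proof.
move=> le_ij; apply: tensor_pull_eq => x a.
by rewrite !ffunE; apply: unbumpS_bump.
Qed.

Fact tensor_face_degen_eq p (j : 'I_p.+1) (T : tensor p) :
  tensor_face (widen_ord (leqnSn _) j) (tensor_degen j T) = T.
Proof. by apply: tensor_pull_id => x a; rewrite !ffunE; apply: bumpK. Qed.

Fact tensor_face_degen_eqS p (j : 'I_p.+1) (T : tensor p) :
  tensor_face (lift ord0 j) (tensor_degen j T) = T.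
Proof.
by apply: tensor_pull_id => x a; rewrite !ffunE; apply: unbump_bump_self.
Qed.

Fact tensor_face_degen_gt p (i : 'I_p.+2) (j : 'I_p.+1) (T : tensor p.+1) :
  (j < i)%N ->
  tensor_face (lift ord0 i) (tensor_degen (widen_ord (leqnSn _) j) T)
    = tensor_degen j (tensor_face i T).
Proof.
move=> lt_ji; apply: tensor_pull_eq => x a.
by rewrite !ffunE; apply: unbump_bumpS.
Qed.

Definition diagonalTensor : simplicialModule A :=
  SimplicialModule tensor_face_face tensor_degen_degen tensor_face_degen_lt
    tensor_face_degen_eq tensor_face_degen_eqS tensor_face_degen_gt.

End DiagonalTensor.

(* Main.v *)
Require Import Defs.
From HB Require Import structures.
From mathcomp Require Import all_boot all_order all_algebra.

(** Shifting all coordinates down by one, and extending by 0 to the points that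
    have a zero coordinate, gives an extra degeneracy h: d_0 h = id and
    d_{i+1} h = h d_i. In degree 0 the remaining face d_1 h vanishes, because
    there the axes of minimal length reduce to [0], so that every point of I_0
    has a zero coordinate. Hence h is a contraction. *)

Set Implicit Arguments.
Unset Strict Implicit.
Unset Printing Implicit Defensive.

Import GRing.Theory.
Local Open Scope ring_scope.

(** In the boundary of [h x] the face 0 contributes [x]; each face i+1 carries the sign opposite to
    that of face i inside [h] of the boundary of [x], so the rest cancels. *)
Lemma extra_degen_contractible (A : comPzRingType) (X : simplicialModule A)
    (h : forall p, {linear X p -> X p.+1}) :
  (forall p (x : X p), face X ord0 (h p x) = x) ->
  (forall p (i : 'I_p.+2) (x : X p.+1),
     face X (lift ord0 i) (h p.+1 x) = h p (face X i x)) ->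
  (forall x : X 0%N, face X (lift ord0 ord0) (h 0%N x) = 0) ->
  contractible (unaugmentedComplex X).
Proof.
move=> face0_h faceS_h face1_h; exists h; split=> [x|p x] /=.
  by rewrite /alt_face big_ord_recl big_ord1 face0_h face1_h scaler0 addr0 scale1r.
rewrite /alt_face big_ord_recl face0_h scale1r -addrA linear_sum -big_split /=.
rewrite big1 ?addr0 // => i _.
by rewrite faceS_h linearZ /= /bump add1n exprS mulN1r scaleNr addNr.
Qed.

Lemma shape_min_in k (s : k.-tuple nat) : (0 < k)%N -> shape_min s \in s.
Proof.
move=> k_gt0; rewrite /shape_min big_seq.
apply: (big_ind (fun m => m \in tval s)) => //.
  by rewrite -nth0 mem_nth ?size_tuple.
by move=> m n ms ns; rewrite /minn; case: ifP.
Qed.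

Lemma excess_eq0 k (s : k.-tuple nat) :
  (0 < k)%N -> exists a, excess s a = 0%N.
Proof.
move=> /(shape_min_in s)/tnthP[a min_eq]; exists a.
by rewrite /excess /shape_dim min_eq subnn.
Qed.

Section ExtraDegeneracy.
Variables (A : comPzRingType) (k : nat) (s : k.-tuple nat).

Definition all_pos p (x : multiIndex s p) : bool := [forall a, (0 < x a)%N].

(* [Sigma ord0] lowers every positive coordinate by one. *)
Definition tensor_extra p (T : tensor A s p) : tensor A s p.+1 :=
  [ffun x => if all_pos x then T (Sigma ord0 x) else 0].

Fact tensor_extra_is_linear p : linear (@tensor_extra p).
Proof.
move=> c T U; apply/ffunP=> x; rewrite !ffunE.
by case: ifP => _; rewrite ?scaler0 ?addr0.
Qed.

HB.instance Definition _ p :=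
  GRing.isLinear.Build A (tensor A s p) (tensor A s p.+1) *:%R
    (@tensor_extra p) (tensor_extra_is_linear (p := p)).

Lemma all_pos_Delta0 p (x : multiIndex s p) : all_pos (Delta ord0 x).
Proof. by apply/forallP=> a; rewrite ffunE. Qed.

(** A coface of index i+1 fixes 0 and keeps positive values positive. *)
Lemma all_pos_DeltaS p (i : 'I_p.+1) (x : multiIndex s p) :
  all_pos (Delta (lift ord0 i) x) = all_pos x.
Proof.
rewrite /all_pos; apply: eq_forallb => a.
rewrite !ffunE /= /bump.
by case: (nat_of_ord (x a)) => [|m]; rewrite ?addnS.
Qed.

Lemma face0_tensor_extra p (T : tensor A s p) :
  tensor_face A s ord0 (tensor_extra T) = T.
Proof.
apply/ffunP=> x; rewrite !ffunE all_pos_Delta0; congr (T _).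
by apply/ffunP=> a; apply/val_inj; rewrite !ffunE; apply: bumpK.
Qed.

Lemma faceS_tensor_extra p (i : 'I_p.+2) (T : tensor A s p.+1) :
  tensor_face A s (lift ord0 i) (tensor_extra T)
    = tensor_extra (tensor_face A s i T).
Proof.
apply/ffunP=> x; rewrite !ffunE all_pos_DeltaS; case: ifP => // /forallP x_pos.
(* On coordinates this is sigma_0 delta_{i+1} = delta_i sigma_0. It holds at positive values, but
   for i = 0 it fails at 0, hence the extension by zero. *)
congr (T _); apply/ffunP=> a; apply/val_inj; rewrite !ffunE /=.
have := x_pos a; rewrite /unbump /bump /=.
by case: (nat_of_ord (x a)) => // m _; rewrite addnS !subn1 /= add1n ltnS.
Qed.

Lemma face1_tensor_extra (T : tensor A s 0%N) :
  (0 < k)%N -> tensor_face A s (lift ord0 ord0) (tensor_extra T) = 0.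
Proof.
move=> /(excess_eq0 s)[a exc0]; apply/ffunP=> x.
rewrite !ffunE all_pos_DeltaS ifN //; apply/forallPn; exists a.
(* [side s 0 a] is convertible to [excess s a], which is 0, so the ordinal bound on [x a] leaves
   only the value 0. *)
by rewrite -leqNgt -[leqRHS]exc0 -ltnS (ltn_ord (x a)).
Qed.

End ExtraDegeneracy.

Theorem mainTheorem5 (A : comPzRingType) (k : nat) (s : k.-tuple nat) :
  (0 < k)%N -> (forall a : 'I_k, (0 < tnth s a)%N) ->
  contractible (unaugmentedComplex (diagonalTensor A s)).
Proof.
move=> k_gt0 _.
apply: (@extra_degen_contractible A (diagonalTensor A s)
         (fun p => @tensor_extra A k s p)).
- exact: face0_tensor_extra.
- exact: faceS_tensor_extra.
- by move=> T; apply: face1_tensor_extra.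
Qed.
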